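(* The following are equivalent for a commutative semiring $R$ (in particular for a commutative ring $R$): (1) $R$ is an AMin-semiring, i.e. every minimal prime ideal of $R$ is absolutely minimal; (2) $\mathrm{Min}(R)$ is discrete; (3) $P(R)=\bigcap_{Q\in\mathrm{Min}(R)}Q$ is an irredundant intersection (i.e. no minimal prime $Q$ can be omitted from it).
   Context: A semiring is a set $R$ with operations $+,\cdot$ such that $(R,+,0)$ is a commutative monoid, $(R,\cdot,1)$ is a monoid, multiplication distributes over addition from both sides, $0r=0=r0$ for all $r\in R$, and $1\ne 0$; it is commutative if $\cdot$ is. Every ring (with $1\neq 0$) is a semiring. An ideal of a commutative semiring is an additive submonoid closed under multiplication by $R$; prime ideals are (proper and) defined as for rings. $\mathrm{Spec}(R)$ is the set of prime ideals with the Zariski topology (closed sets $V(I)=\{P: I\subseteq P\}$ for ideals $I$); $\mathrm{Min}(R)$ is the set of minimal prime ideals with the subspace topology. $P(R)=\bigcap_{P\in\mathrm{Spec}(R)}P$. A minimal prime $Q$ is absolutely minimal iff the intersection of all the other minimal primes is not contained in $Q$ (the empty intersection being $R$). *)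

(* Defs.v *)
From HB Require Import structures.
From mathcomp Require Import all_boot all_order all_algebra.
From mathcomp Require Import boolp classical_sets.
From mathcomp Require Import topology_structure subtype_topology.

Set Implicit Arguments.
Unset Strict Implicit.
Unset Printing Implicit Defensive.

Import GRing.Theory.
Local Open Scope classical_set_scope.
Local Open Scope ring_scope.

(* The ideals of ring_quotient require a ring; these are for semirings. *)
Definition ideal (R : comNzSemiRingType) (I : set R) : Prop :=
  [/\ I 0,
      forall x y, I x -> I y -> I (x + y)
    & forall r x, I x -> I (r * x)].

Definition prime_ideal (R : comNzSemiRingType) (P : set R) : Prop :=
  [/\ ideal P, P != setT & forall x y, P (x * y) -> P x \/ P y].

Record Spec (R : comNzSemiRingType) : Type := MkSpec {
  spec_set :> set R;
  spec_prime : prime_ideal spec_set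
}.

HB.instance Definition _ (R : comNzSemiRingType) := gen_eqMixin (Spec R).
HB.instance Definition _ (R : comNzSemiRingType) := gen_choiceMixin (Spec R).

Lemma spec_inj (R : comNzSemiRingType) (P Q : Spec R) :
  P = Q :> set R -> P = Q.
Proof.
by case: P Q => [P hP] [Q hQ] /= PQ; subst Q; rewrite (Prop_irrelevance hP hQ).
Qed.

Section Zariski.
Variable R : comNzSemiRingType.
Implicit Types (I J : set R) (U : set (Spec R)).

Definition zariskiV I : set (Spec R) := [set P | I `<=` P].

Definition zariski_open U : Prop :=
  exists2 I, ideal I & U = ~` zariskiV I.

Lemma zariski_openT : zariski_open setT.
Proof.
exists setT => //; apply/esym; rewrite -subTset => P _ /= TP.
by case: (spec_prime P) => _ /eqP + _; apply; rewrite -subTset.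
Qed.

Lemma zariski_openI : setI_closed zariski_open.
Proof.
move=> U W [I [I0 ID IM] ->] [J [J0 JD JM] ->].
exists (I `&` J).
  split=> [//|x y [Ix Jx] [Iy Jy]|r x [Ix Jx]].
    by split; [exact: ID | exact: JD].
  by split; [exact: IM | exact: JM].
rewrite -setCU; congr (~` _); apply/seteqP; split=> P /=.
  by case=> sP x [Ix Jx]; apply: sP.
move=> IJP; apply: contrapT => /not_orP[].
move=> /existsNP[x /not_implyP[Ix Px]] /existsNP[y /not_implyP[Jy Py]].
have : spec_set P (x * y).
  by apply: IJP; split; [rewrite mulrC; exact: IM | exact: JM].
by case: (spec_prime P) => _ _ /[apply] -[].
Qed.

Lemma zariski_open_bigU (T : Type) (f : T -> set (Spec R)) :
  (forall i, zariski_open (f i)) -> zariski_open (\bigcup_i f i).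
Proof.
move=> fo.
have /choice[I fI] : forall i, exists I, ideal I /\ f i = ~` zariskiV I.
  by move=> i; have [I idI fI] := fo i; exists I.
pose J := [set x | forall K, ideal K -> (forall i, I i `<=` K) -> K x].
exists J.
  split=> [K [] //|x y Jx Jy K idK IK|r x Jx K idK IK].
    by case: (idK) => _ KD _; apply: KD; [exact: Jx | exact: Jy].
  by case: (idK) => _ _ KM; apply: KM; exact: Jx.
apply/seteqP; split=> P /=.
  move=> [i _]; rewrite (fI i).2 => nIP JP; apply: nIP => x Ix.
  by apply: JP => K _ IK; exact: IK Ix.
move=> nJP; apply: contrapT => nf; apply: nJP => x Jx.
apply: (Jx P) => [|i]; first by case: (spec_prime P).
apply: contrapT => nIP; apply: nf; exists i => //.
by rewrite (fI i).2.
Qed.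

HB.instance Definition _ := isOpenTopological.Build (Spec R)
  zariski_openT zariski_openI zariski_open_bigU.

Lemma zariski_openE : @open (Spec R) = zariski_open.
Proof. by []. Qed.

Lemma zariski_closedP (F : set (Spec R)) :
  closed F <-> exists2 I, ideal I & F = zariskiV I.
Proof.
rewrite -openC zariski_openE; split=> -[I idI FI]; exists I => //.
  by apply: setC_inj.
by rewrite FI.
Qed.

End Zariski.

(* [set_type (Min R)] carries the subspace topology: it is the
   [initial_topology] of the inclusion into [Spec R]. *)
Definition Min (R : comNzSemiRingType) : set (Spec R) :=
  [set P : Spec R | forall Q : Spec R, Q `<=` P -> Q = P].
Arguments Min : clear implicits.

(* When Q is the only minimal prime, the bigcap is setT. *)
Definition absolutely_minimal (R : comNzSemiRingType) (Q : Spec R) : Prop :=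
  Min R Q /\ ~ (\bigcap_(P in Min R `\ Q) (P : set R) `<=` Q).

Definition AMin_semiring (R : comNzSemiRingType) : Prop :=
  forall Q : Spec R, Min R Q -> absolutely_minimal Q.
Arguments AMin_semiring : clear implicits.

Definition prime_radical (R : comNzSemiRingType) : set R :=
  \bigcap_(P in [set: Spec R]) (P : set R).
Arguments prime_radical : clear implicits.

Definition discrete (T : topologicalType) : Prop := forall A : set T, open A.

Definition irredundant_bigcap (R : comNzSemiRingType) (A : set (Spec R)) : Prop :=
  forall Q : Spec R, A Q ->
    \bigcap_(P in A `\ Q) (P : set R) <> \bigcap_(P in A) (P : set R).

(* Main.v *)
Require Import Defs.
From HB Require Import structures.
From mathcomp Require Import all_boot all_order all_algebra.
From mathcomp Require Import boolp classical_sets.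
From mathcomp Require Import topology_structure subtype_topology.
Local Open Scope classical_set_scope.

(** For a minimal prime Q, let J be the intersection of the other minimal
    primes. An open set ~ V(I) meets Min(R) exactly in {Q} iff I is contained
    in J but not in Q, so {Q} is open in Min(R) iff J is not contained in Q
    (take I = J). Irredundancy at Q says the same thing. The equality between
    P(R) and the intersection of Min(R) holds in every R, since by Zorn's lemma
    every prime contains a minimal one. *)

Import GRing.Theory.
Local Open Scope ring_scope.

Section MinimalPrimes.
Context {R : comNzSemiRingType}.
Implicit Types (P Q : Spec R) (A : set (Spec R)).

Lemma ideal_bigcap_Spec A : ideal (\bigcap_(P in A) (P : set R)).
Proof.
split=> [P _|x y Ix Iy P AP|r x Ix P AP]; case: (spec_prime P) => -[P0 PD PM] _ _.
- exact: P0.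
- by apply: PD; [exact: Ix | exact: Iy].
- by apply: PM; exact: Ix.
Qed.

(** If [x] is missing from [P] and [y] from [Q], the smaller of these two primes misses both and so
    cannot contain [x * y]. Nonemptiness of [A] keeps the intersection proper. *)
Lemma prime_ideal_bigcap_chain A : A !=set0 ->
  total_on A (fun P Q => (P : set R) `<=` Q) ->
  prime_ideal (\bigcap_(P in A) (P : set R)).
Proof.
move=> [P0 AP0] tot; split; first exact: ideal_bigcap_Spec.
  apply/eqP => capT; case: (spec_prime P0) => _ /eqP + _; apply.
  by rewrite -subTset -capT => x; apply.
move=> x y capxy; apply: contrapT => /not_orP[].
move=> /existsNP[P /not_implyP[AP nPx]] /existsNP[Q /not_implyP[AQ nQy]].
have prime S : A S -> spec_set S x \/ spec_set S y.
  by move=> AS; case: (spec_prime S) => _ _; apply; exact: capxy.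
have [PQ|QP] := tot P Q AP AQ.
  by have [//|/PQ] := prime P AP.
by have [/QP|] := prime Q AQ.
Qed.

Lemma exists_minimal_prime P : exists2 Q, Min R Q & (Q : set R) `<=` P.
Proof.
pose T := {Q : Spec R | (Q : set R) `<=` P}.
(* Reverse inclusion, so that a maximal element for Zorn is a prime minimal among those below
   [P]. *)
pose ge (s t : T) := `[< (sval t : set R) `<=` sval s >].
have [|||[Q QP] Qmin] := @ZL_preorder T (exist _ P (@subset_refl _ _)) ge.
- by move=> t; apply/asboolP.
- move=> r s t /asboolP sr /asboolP ts; apply/asboolP.
  exact: subset_trans ts sr.
- move=> C tot; have [[t0 Ct0]|C0] := pselect (C !=set0); last first.
    (* The empty chain is bounded by [P] itself: its intersection would be all of [R], which is not
       prime. *)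
    by exists (exist _ P (@subset_refl _ _)) => s Cs; case: C0; exists s.
  have capP : prime_ideal (\bigcap_(Q in sval @` C) (Q : set R)).
    apply: prime_ideal_bigcap_chain; first by exists (sval t0), t0.
    move=> _ _ [s Cs <-] [t Ct <-].
    by case: (tot s t Cs Ct) => /asboolP; [right|left].
  have capsub t : C t -> MkSpec capP `<=` sval t.
    by move=> Ct x; apply; exists t.
  exists (exist _ (MkSpec capP) (subset_trans (capsub t0 Ct0) (svalP t0))).
  by move=> t Ct; apply/asboolP; exact: capsub.
(* Minimality among the primes below [P] is minimality among all primes, since any [Q'] inside [Q]
   also lies below [P]. *)
exists Q => // Q' Q'Q; apply: spec_inj; apply/seteqP; split=> //.
have /Qmin := asboolT Q'Q : ge (exist _ Q QP) (exist _ Q' (subset_trans Q'Q QP)).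
by move/asboolP.
Qed.

Lemma prime_radicalE :
  prime_radical R = \bigcap_(Q in Min R) (spec_set Q).
Proof.
apply/seteqP; split=> x; first by move=> radx Q _; exact: radx.
move=> Minx P _; have [Q MinQ QP] := exists_minimal_prime P.
by apply: QP; exact: Minx.
Qed.

Lemma open_set1_MinP (q : set_type (Min R)) :
  open [set q] <->
  ~ (\bigcap_(P in Min R `\ sval q) (P : set R) `<=` sval q).
Proof.
have Minq : Min R (sval q) by exact: set_mem (svalP q).
split=> [[U [I idI ->]] qE capq|ncap].
  have : [set q] q by [].
  rewrite -qE; apply => x Ix; apply: capq => P [MinP Pq].
  (* A minimal prime [P] missing some [x] of [I] lies in the open set cut out by [I], whose only
     minimal prime is [q]. *)
  apply: contrapT => nPx; apply: Pq.
  pose p : set_type (Min R) := exist _ P (mem_set MinP).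
  suff : [set q] p by move=> /= <-.
  by rewrite -qE => IP; apply: nPx; exact: IP.
pose J := \bigcap_(P in Min R `\ sval q) (P : set R).
exists (~` zariskiV J); first by exists J => //; exact: ideal_bigcap_Spec.
apply/seteqP; split=> [p nJp|_ -> //].
(* Were [p] different from [q], it would be one of the primes intersected in [J], hence contain
   [J]. *)
apply: contrapT => pq; apply: nJp => x Jx; apply: Jx.
split; first exact: set_mem (svalP p).
by move=> /eq_sig_hprop pq'; apply: pq; apply: pq' => ?; exact: Prop_irrelevance.
Qed.

Lemma discrete_MinP :
  discrete (set_type (Min R)) <->
  forall Q, Min R Q -> ~ (\bigcap_(P in Min R `\ Q) (P : set R) `<=` Q).
Proof.
split=> [disc Q MinQ|ncap A].
  exact/(open_set1_MinP (exist _ Q (mem_set MinQ))).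
(* Every set is the union of its points, so open singletons suffice. *)
rewrite (_ : A = \bigcup_(q in A) [set q]).
  apply: bigcup_open => q _; apply/open_set1_MinP; apply: ncap.
  exact: set_mem (svalP q).
by rewrite bigcup_imset1 image_id.
Qed.

(** Turns irredundancy at [Q] into the non-inclusion that defines absolute minimality. *)
Lemma bigcap_setD1_eqP A Q : A Q ->
  \bigcap_(P in A `\ Q) (P : set R) = \bigcap_(P in A) (P : set R) <->
  \bigcap_(P in A `\ Q) (P : set R) `<=` Q.
Proof.
move=> AQ; split=> [->|capQ]; first by move=> x; apply.
apply/seteqP; split=> x capx P; last by move=> [AP _]; exact: capx.
move=> AP; have [->|PQ] := pselect (P = Q); first exact: capQ.
by apply: capx.
Qed.

End MinimalPrimes.

Theorem corollary2p28 (R : comNzSemiRingType) :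
  (AMin_semiring R <-> discrete (set_type (Min R))) /\
  (discrete (set_type (Min R)) <->
     prime_radical R = \bigcap_(Q in Min R) (spec_set Q) /\
     irredundant_bigcap (Min R)).
Proof.
rewrite discrete_MinP; split.
  split=> [amin Q /amin[] //|ncap Q MinQ].
  by split=> //; exact: ncap.
split=> [ncap|[_ irr] Q MinQ].
  split; first exact: prime_radicalE.
  by move=> Q MinQ; rewrite bigcap_setD1_eqP//; exact: ncap.
by rewrite -bigcap_setD1_eqP//; exact: irr.
Qed.
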